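(* Let $X$ and $Z$ be Hausdorff, locally convex topological vector spaces, let $C\subseteq Z$ be a convex, pointed cone with nonempty interior, and let $K$ be a nonempty, convex and compact subset of $X$. Let $D\subseteq K$ be a self segment-dense set in $K$ and consider a mapping $F:K\to L(X,Z)$ satisfying (i) for all $x\in K$, the mapping $y\mapsto\langle F(y),y-x\rangle$ is $C$-upper semicontinuous on $K\setminus D$; (ii) for all $x\in D$, the mapping $y\mapsto\langle F(y),y-x\rangle$ is $C$-convex on $D$. Then there exists $x_0\in K$ such that $\langle F(y),y-x_0\rangle\notin -\operatorname{int} C$ for all $y\in K$.
   Context: All vector spaces are real. $\operatorname{int}$ denotes interior and $\operatorname{cl}$ closure. $L(X,Z)$ is the set of all linear and continuous operators from $X$ to $Z$; for $x^*\in L(X,Z)$ and $x\in X$, $\langle x^*,x\rangle$ denotes the vector $x^*(x)\in Z$. A set $C\subseteq Z$ is a cone if $tc\in C$ for all $c\in C$ and $t\ge 0$; it is convex if $C+C=C$, and pointed if $C\cap(-C)=\{0\}$. Write $z_1\le z_2$ iff $z_2-z_1\in C$. $C$-upper semicontinuity: a map $g:K\to Z$ is $C$-upper semicontinuous at $x\in K$ if for any neighborhood $V$ of $g(x)$ there exists a neighborhood $U$ of $x$ such that $g(u)\in V-C$ for all $u\in U\cap K$. It is $C$-upper semicontinuous on a subset $S\subseteq K$ if it is so, as a map on $K$, at every point of $S$. $C$-convexity: for a (not necessarily convex) set $D$, $g$ is $C$-convex on $D$ if for all $n\in\mathbb N$, $x_1,\dots,x_n\in D$ and $\lambda_1,\dots,\lambda_n\ge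 0$ with $\sum_{i=1}^n\lambda_i=1$ such that $\sum_{i=1}^n\lambda_i x_i\in D$, one has $g\left(\sum_{i=1}^n\lambda_i x_i\right)\le\sum_{i=1}^n\lambda_i g(x_i)$. Self segment-dense set: let $U\subseteq V\subseteq X$ with $V$ convex. $U$ is self segment-dense in $V$ if $U$ is dense in $V$ (i.e. $V\subseteq\operatorname{cl}U$) and for all $x,y\in U$ the set $[x,y]\cap U$ is dense in $[x,y]$, where $[x,y]=\{x+t(y-x):t\in[0,1]\}$.
   Formalization: Z is additionally assumed not to be the zero space; for Z = {0} the only cone is C = {0} with int C = {0}, and the conclusion always fails because ⟨F(y), y−x₀⟩ = 0 lies in −int C. *)

(* Defs.v *)
From HB Require Import structures.
From mathcomp Require Import all_boot all_order all_algebra.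
From mathcomp Require Import all_classical all_reals all_analysis.

Set Implicit Arguments.
Unset Strict Implicit.
Unset Printing Implicit Defensive.

Import Order.TTheory GRing.Theory Num.Theory.
Import numFieldNormedType.Exports.

Local Open Scope classical_set_scope.
Local Open Scope ring_scope.

(* [tvsType R] is the library's type of locally convex topological vector
   spaces; Hausdorffness is a separate predicate, [hausdorff_space]. *)

(* The set L(X, Z), as a set of linear maps. *)
Definition linear_continuous_operators (R : realType) (X Z : tvsType R) :
    set {linear X -> Z} :=
  [set f : {linear X -> Z} | continuous f].

Definition cone (R : realType) (Z : lmodType R) (C : set Z) : Prop :=
  forall (t : R) (c : Z), 0 <= t -> C c -> C (t *: c).

Definition convex_cone (R : realType) (Z : lmodType R) (C : set Z) : Prop :=
  cone C /\ [set c1 + c2 | c1 in C & c2 in C] = C.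

Definition pointed_cone (R : realType) (Z : lmodType R) (C : set Z) : Prop :=
  C `&` [set - c | c in C] = [set 0].

Definition cone_le (R : realType) (Z : lmodType R) (C : set Z) (z1 z2 : Z) :
    Prop :=
  C (z2 - z1).

(* [g] stands for a map K -> Z: its values outside of [K] are irrelevant. *)
Definition cone_usc_at (R : realType) (X Z : tvsType R) (C : set Z) (K : set X)
    (g : X -> Z) (x : X) : Prop :=
  forall V : set Z, nbhs (g x) V ->
    exists2 U : set X, nbhs x U &
      forall u, (U `&` K) u -> [set v - c | v in V & c in C] (g u).

Definition cone_usc_on (R : realType) (X Z : tvsType R) (C : set Z) (K : set X)
    (g : X -> Z) (S : set X) : Prop :=
  forall x, S x -> cone_usc_at C K g x.

Definition cone_convex_on (R : realType) (X Z : lmodType R) (C : set Z)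
    (D : set X) (g : X -> Z) : Prop :=
  forall (n : nat) (x : 'I_n -> X) (l : 'I_n -> R),
    (forall i, D (x i)) ->
    (forall i, 0 <= l i) ->
    \sum_(i < n) l i = 1 ->
    D (\sum_(i < n) l i *: x i) ->
    cone_le C (g (\sum_(i < n) l i *: x i)) (\sum_(i < n) l i *: g (x i)).

Definition closed_segment (R : realType) (X : lmodType R) (x y : X) : set X :=
  [set x + t *: (y - x) | t in [set` `[0 : R, 1]]].

Definition self_segment_dense (R : realType) (X : tvsType R) (U V : set X) :
    Prop :=
  [/\ U `<=` V, convex_set V, V `<=` closure U &
      forall x y, U x -> U y ->
        closed_segment x y `<=` closure (closed_segment x y `&` U)].

(* Main.v *)
(* Fix e in the interior of C. A maximal cone containing C and avoiding -e yields
   a linear functional p, nonnegative on C, with p e = 1, hence positive on the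
   interior of C and upper semicontinuous. It is enough to find x0 in K with
   p (F y (y - x0)) >= 0 for all y in D: (i) and the density of D then exclude
   F y (y - x0) in - int C for y in K \ D. After scalarization the constraints
   are affine in x0, so Brouwer's theorem (KKM) is not needed: by compactness one
   treats finitely many y_i with an arbitrarily small slack, and by a theorem of
   the alternative for matrices either they are solvable in co {y_i}, or some
   convex combination of the constraints with weights l is uniformly negative on
   co {y_i}. The latter contradicts (ii) at z = sum_i l_i y_i when z is in D, and
   self segment-density allows one to perturb l so that z is in D. *)
Require Import Defs.
From HB Require Import structures.
From mathcomp Require Import all_boot all_order all_algebra.
From mathcomp Require Import all_classical all_reals all_analysis.
From mathcomp Require Import finmap ring lra.

Set Implicit Arguments.
Unset Strict Implicit.
Unset Printing Implicit Defensive.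

Import Order.TTheory GRing.Theory Num.Theory.
Import numFieldNormedType.Exports.

Local Open Scope classical_set_scope.
Local Open Scope ring_scope.

(** * Positive linear functionals on a cone with an order unit *)

Section PositiveFunctional.
Variables (R : realType) (Z : lmodType R).
Implicit Types (W M : set Z) (e z : Z).

Let wedge W := cone W /\ forall u v, W u -> W v -> W (u + v).

(** Zorn's lemma gives a maximal wedge. If adjoining [z] to it captures [- e], then
    [- e = m + s *: z] with [s > 0], and solving for [- z] puts [- z] in the wedge. *)
Let total_wedge e : forall W, wedge W -> W e -> ~ W (- e) ->
  exists M, [/\ W `<=` M, wedge M, ~ M (- e) & forall z, M z \/ M (- z)].
Proof.
move=> W wW We WNe.
(* The conditions bear on the union of [W] and [M], so that the empty chain, whose union is empty,
   is covered as well. *)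
pose P := [set M | wedge (W `|` M) /\ ~ (W `|` M) (- e)].
have [A AP Atot|M [[wM MNe] Mmax]] := @Zorn_bigcup Z P.
  have sub X : A X -> W `|` X `<=` W `|` \bigcup_(X in A) X.
    by move=> AX z [|] ?; [left | right; exists X].
  have mem z : (W `|` \bigcup_(X in A) X) z ->
      W z \/ exists2 X, A X & (W `|` X) z.
    by move=> [?|[X AX Xz]]; [left | right; exists X => //; right].
  split.
    split=> [t c t0|u v].
      move=> /mem[Wc|[X AX Xc]]; first by left; exact: wW.1.
      by apply: (sub X) => //; apply: (AP _ AX).1.1.
    move=> /mem[Wu|[X AX Xu]] /mem[Wv|[Y AY Yv]].
    - by left; exact: wW.2.
    - by apply: (sub Y) => //; apply: (AP _ AY).1.2 => //; left.
    - by apply: (sub X) => //; apply: (AP _ AX).1.2 => //; left.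
    - have [XY|YX] := Atot _ _ AX AY.
        apply: (sub Y) => //; apply: (AP _ AY).1.2 => //.
        by case: Xu => [?|/XY ?]; [left|right].
      apply: (sub X) => //; apply: (AP _ AX).1.2 => //.
      by case: Yv => [?|/YX ?]; [left|right].
  by move=> h; have [/WNe//|[X AX]] := mem _ h; exact: (AP _ AX).2.
exists (W `|` M); split => // z.
have [Mz|NMz] := pselect ((W `|` M) z); [by left|right].
pose N := [set m + s *: z | m in W `|` M & s in [set s | 0 <= s]].
have MN : W `|` M `<=` N.
  by move=> m Mm; exists m => //; exists 0 => //=; rewrite scale0r addr0.
have WN : W `|` N = N by apply/setUidPr => m Wm; apply: MN; left.
have Nz : N z.
  exists 0; last by exists 1 => /=; rewrite ?ler01// scale1r add0r.
  by rewrite -(scale0r e); left; exact: wW.1.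
have wN : wedge N.
  split=> [t _ t0 [m Mm [s s0 <-]]|_ _ [m Mm [s s0 <-]] [m' Mm' [s' s'0 <-]]].
    exists (t *: m); first exact: wM.1.
    by exists (t * s); rewrite /= ?mulr_ge0// scalerDr scalerA.
  exists (m + m'); first exact: wM.2.
  by exists (s + s'); rewrite /= ?addr_ge0// scalerDl addrACA.
have [Ne|NNe] := pselect (N (- e)); last first.
  exfalso; apply: (Mmax N); last by split; rewrite WN.
  split=> [m Mm|NM]; first by apply: MN; right.
  by apply: NMz; right; exact: NM.
case: Ne => m Mm [s /= s0 mse].
have s_neq0 : s != 0.
  by apply/eqP => s0'; apply: MNe; rewrite -mse s0' scale0r addr0.
have -> : - z = s^-1 *: (m + e).
  rewrite -[e]opprK -mse opprD addrA subrr sub0r scalerN scalerA.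
  by rewrite mulVf// scale1r.
by apply: wM.1; [rewrite invr_ge0 | apply: wM.2 => //; left].
Qed.

(** The third hypothesis makes [e] an order unit, so in the total preorder of a total wedge every
    vector is comparable with multiples of [e], as in a Dedekind cut. Uniqueness of the cut yields
    linearity. *)
Lemma cone_positive_functional W e : cone W ->
    (forall u v, W u -> W v -> W (u + v)) ->
    (forall z, exists t, W (t *: e + z)) -> W e -> ~ W (- e) ->
  exists2 f : {scalar Z}, f e = 1 & forall z, W z -> 0 <= f z.
Proof.
move=> coneW addW unitW We WNe.
have [M [WM [coneM addM] MNe Mtot]] := total_wedge (conj coneW addW) We WNe.
have Mge t : M (t *: e) -> 0 <= t.
  rewrite leNgt => Mte; apply/negP => t0; apply: MNe.
  have -> : - e = (- t^-1) *: (t *: e).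
    by rewrite scalerA mulNr mulVf ?lt_eqF// scaleN1r.
  by apply: coneM => //; rewrite oppr_ge0 invr_le0 ltW.
(* the functional maps z to the cut it makes in the line R e, ordered by M *)
pose cut z r := (forall t, r < t -> M (t *: e - z)) /\
                (forall t, t < r -> M (z - t *: e)).
have cut_le z r r' : cut z r -> cut z r' -> r' <= r.
  move=> [ur _] [_ lr']; rewrite leNgt; apply/negP => rr'.
  pose t1 := (r + r') / 2; have rt1 : r < t1 by rewrite /t1; lra.
  pose t2 := (t1 + r') / 2; have t2r : t2 < r' by rewrite /t2 /t1; lra.
  have := addM _ _ (ur _ rt1) (lr' _ t2r).
  by rewrite subrKA -scalerBl => /Mge; rewrite /t2 /t1; lra.
have cut_uniq z r r' : cut z r -> cut z r' -> r = r'.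
  by move=> zr zr'; apply/le_anti; rewrite (cut_le z r')// (cut_le z r).
(* The order unit applied to [- z] and [z] makes [E] nonempty and bounded below. Above [inf E] one
   adds a multiple of [e]; below it, totality of [M] decides. *)
have cut_ex z : exists r, cut z r.
  pose E := [set t | M (t *: e - z)].
  have hE : has_inf E.
    split; first by have [t Wt] := unitW (- z); exists t; exact: WM.
    have [t /WM Wt] := unitW z; exists (- t) => x Ex.
    have := addM _ _ Ex Wt; rewrite [t *: e + z]addrC subrKA -scalerDl.
    by move=> /Mge; lra.
  have eN t : 0 <= t -> M (t *: e) by move=> t0; apply: coneM => //; exact: WM.
  exists (inf E); split => t.
    rewrite -subr_gt0 => /inf_adherent/(_ hE)[x Ex].
    rewrite addrC subrK => xt.
    have -> : t *: e - z = (t - x) *: e + (x *: e - z).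
      by rewrite addrA -scalerDl subrK.
    by apply: addM => //; apply: eN; rewrite subr_ge0 ltW.
  move=> tE; case: (Mtot (t *: e - z)) => [Et|]; last by rewrite opprB.
  by have := ge_inf hE.2 Et; rewrite leNgt tE.
have [f fP] := choice cut_ex.
(* The sum of the two cuts is a cut of [x + y]: the gap between [t] and that sum is shared equally
   by [x] and [y]. *)
have fD x y : f (x + y) = f x + f y.
  apply: (cut_uniq (x + y)) => //.
  have [ux lx] := fP x; have [uy ly] := fP y; split=> t tlt.
    pose d := (t - f x - f y) / 2.
    have -> : t *: e - (x + y) = (f x + d) *: e - x + ((f y + d) *: e - y).
      rewrite opprD addrACA -scalerDl; congr (_ *: _ + _).
      by rewrite /d; field.
    by apply: addM; [apply: ux|apply: uy]; rewrite /d; lra.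
  pose d := (t - f x - f y) / 2.
  have -> : x + y - t *: e = (x - (f x + d) *: e) + (y - (f y + d) *: e).
    rewrite [RHS]addrACA -opprD -scalerDl; congr (_ - _ *: _).
    by rewrite /d; field.
  by apply: addM; [apply: lx|apply: ly]; rewrite /d; lra.
have f0 : f 0 = 0 by apply: (addrI (f 0)); rewrite -fD !addr0.
have fN x : f (- x) = - f x.
  by apply: (addrI (f x)); rewrite -fD !subrr.
have fZp a x : 0 < a -> f (a *: x) = a * f x.
  move=> a0; apply: (cut_uniq (a *: x)) => //; have [ux lx] := fP x.
  have aE t : t *: e = a *: ((t / a) *: e).
    by rewrite scalerA mulrC divfK// gt_eqF.
  split=> t tlt; rewrite aE -scalerBr; apply: coneM; rewrite ?ltW//.
    by apply: ux; rewrite ltr_pdivlMr// mulrC.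
  by apply: lx; rewrite ltr_pdivrMr// mulrC.
have fZ a x : f (a *: x) = a * f x.
  have [a0|a0|<-] := ltgtP 0 a; first exact: fZp.
    rewrite -[a *: x]opprK -scaleNr fN fZp ?oppr_gt0//.
    by rewrite mulNr opprK.
  by rewrite scale0r f0 mul0r.
have flin : scalar f by move=> a x y; rewrite fD fZ.
exists (HB.pack_for {scalar Z} f
    (GRing.isLinear.Build R Z R^o *%R f flin)) => /=.
  apply: (cut_uniq e) => //; split=> t tlt.
    rewrite -[X in _ - X]scale1r -scalerBl; apply: coneM; last exact: WM.
    by rewrite subr_ge0 ltW.
  rewrite -[X in X - _]scale1r -scalerBl; apply: coneM; last exact: WM.
  by rewrite subr_ge0 ltW.
move=> z /WM Mz; rewrite leNgt; apply/negP => fz0.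
have ht : f z < f z / 2 by lra.
by have := addM _ _ ((fP z).1 _ ht) Mz; rewrite subrK => /Mge; lra.
Qed.

End PositiveFunctional.

(** * Finite systems of linear inequalities *)

(** [W] is the cone generated by the nonnegative orthant and the negated columns of [b]. If it
    contains [- e], rescaling [mu] gives the first case; otherwise a functional positive on [W] has
    the weights [l] as its coordinates. *)
Lemma matrix_alternative (R : realType) (n m : nat) (b : 'I_n.+1 -> 'I_m -> R) :
  (exists mu : 'I_m -> R, [/\ forall j, 0 <= mu j, \sum_j mu j = 1 &
     forall i, 0 <= \sum_j b i j * mu j]) \/
  (exists l : 'I_n.+1 -> R, [/\ forall i, 0 <= l i, \sum_i l i = 1 &
     forall j, \sum_i l i * b i j <= 0]).
Proof.
pose W := [set u : 'rV[R]_n.+1 | exists2 mu : 'I_m -> R, forall j, 0 <= mu j &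
  forall i, 0 <= u 0 i + \sum_j b i j * mu j].
pose e : 'rV[R]_n.+1 := const_mx 1.
have Wnneg (u : 'rV[R]_n.+1) : (forall i, 0 <= u 0 i) -> W u.
  move=> u0; exists (fun=> 0) => // i.
  by rewrite big1 ?addr0// => j _; rewrite mulr0.
have We : W e by apply: Wnneg => i; rewrite mxE ler01.
have [[mu mu0 Wmu]|WNe] := pselect (W (- e)).
  left; pose s := \sum_j mu j.
  have bmu i : 1 <= \sum_j b i j * mu j.
    by have := Wmu i; rewrite !mxE addrC subr_ge0.
  have s0 : 0 < s.
    rewrite lt_neqAle sumr_ge0 ?andbT//; apply/eqP => s0.
    have muE j : mu j = 0 by apply: (psumr_eq0P _ (esym s0)).
    have := bmu ord0; rewrite big1 ?ler10// => j _; by rewrite muE mulr0.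
  exists (fun j => mu j / s); split.
  - by move=> j; rewrite divr_ge0// ltW.
  - by rewrite -mulr_suml divff// gt_eqF.
  - move=> i; under eq_bigr do rewrite mulrA.
    by rewrite -mulr_suml divr_ge0 ?(ltW s0)// (le_trans _ (bmu i)).
right.
have [||z||//|f fe fW] := @cone_positive_functional R 'rV[R]_n.+1 W e.
- move=> t u t0 [mu mu0 Wmu]; exists (fun j => t * mu j) => [j|i].
    by rewrite mulr_ge0.
  rewrite mxE; under eq_bigr do rewrite mulrCA.
  by rewrite -mulr_sumr -mulrDr mulr_ge0.
- move=> u v [mu mu0 Wu] [nu nu0 Wv]; exists (fun j => mu j + nu j) => [j|i].
    by rewrite addr_ge0.
  rewrite mxE; under eq_bigr do rewrite mulrDr.
  by rewrite big_split addrACA addr_ge0.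
- exists (\sum_i `|z 0 i|); apply: Wnneg => i; rewrite !mxE mulr1.
  rewrite (bigD1 i)//= addrAC addr_ge0//; last exact: sumr_ge0.
  by rewrite addrC -lerBlDr sub0r lerNnormlW.
- exact: We.
have fE (u : 'rV[R]_n.+1) : f u = \sum_i u 0 i * f 'e_i.
  rewrite {1}[u]row_sum_delta linear_sum; apply: eq_bigr => i _.
  by rewrite linearZ.
exists (fun i => f 'e_i); split.
- move=> i; apply: fW; apply: Wnneg => j.
  by rewrite mxE ler0n.
- by rewrite -fe fE; apply: eq_bigr => i _; rewrite mxE mul1r.
(* The negated column [j] lies in [W], with the indicator of [j] as [mu]. *)
move=> j; pose u : 'rV[R]_n.+1 := \row_i - b i j.
have : 0 <= f u.
  apply: fW; exists (fun k => (k == j)%:R) => [k|i]; first by rewrite ler0n.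
  rewrite mxE (bigD1 j)//= eqxx mulr1 big1 => [|k /negPf kj].
    by rewrite addr0 addNr.
  by rewrite kj mulr0.
rewrite fE -oppr_le0 -sumrN; congr (_ <= _); apply: eq_bigr => i _.
by rewrite mxE mulNr opprK mulrC.
Qed.

(** * From density in segments to density of weights in the simplex *)

Section SegmentDensity.
Variables (R : realType) (X : tvsType R).

Lemma continuous_line (u v : X) : continuous (fun t : R => u + t *: v).
Proof.
move=> t; apply: (cvg_comp2 (cvg_cst u) _ (@add_continuous X (u, t *: v))).
exact: (cvg_comp2 cvg_id (cvg_cst v) (@scale_continuous R X (t, v))).
Qed.

(* The Hausdorff property is needed to turn density in the segment [x, y], for
   the topology of X, into density of the parameters t in [0, 1]. *)
Lemma segment_dense_parameter (hX : hausdorff_space X) (D : set X) (x y : X)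
    (t eps : R) :
    closed_segment x y `<=` closure (closed_segment x y `&` D) -> D x ->
    0 <= t <= 1 -> 0 < eps ->
  exists s, [/\ 0 <= s <= 1, `|s - t| < eps & D (x + s *: (y - x))].
Proof.
move=> dD Dx t01 eps0.
have [->|xy] := eqVneq y x.
  by exists t; split; rewrite // subrr ?normr0// scaler0 addr0.
pose h (s : R) := x + s *: (y - x).
(* The image of the parameters far from [t] is compact, hence closed, and misses [h t] by
   injectivity; its complement is thus a neighborhood of [h t], where density provides a point of
   [D]. *)
pose far := `[0, 1] `&` ~` ball t eps.
have cfar : compact far.
  apply: compact_closedI; first exact: segment_compact.
  by apply: open_closedC; exact: ball_open.
have clfar : closed (h @` far).
  apply: compact_closed => //; apply: continuous_compact => //.
  by apply: continuous_subspaceT; exact: continuous_line.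
have hinj r s : h r = h s -> r = s.
  move=> /addrI /eqP; rewrite -subr_eq0 -scalerBl scaler_eq0 !subr_eq0.
  by rewrite (negPf xy) orbF => /eqP.
have nfar : nbhs (h t) (~` (h @` far)).
  apply: open_nbhs_nbhs; split; first exact: closed_openC.
  by move=> [s [_ sN] /hinj st]; apply: sN; rewrite st; exact: ballxx.
have ht : closed_segment x y (h t) by exists t => //=; rewrite in_itv.
have [_ [[[s /= s01 <-] Ds] sN]] := dD _ ht _ nfar.
exists s; split => //.
rewrite ltNge; apply/negP => tes; apply: sN; exists s => //; split => //=.
by rewrite -ball_normE /= distrC ltNge tes.
Qed.

(** Induction on the number of points: the renormalized last [n] weights are first moved so that
    their combination [w] lies in [D]; then a parameter near [l ord0] is chosen on the segment from
    [w] to [y ord0]. *)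
Lemma simplex_dense_weights (hX : hausdorff_space X) (D : set X)
    (hD : forall x y, D x -> D y ->
       closed_segment x y `<=` closure (closed_segment x y `&` D))
    (n : nat) (y : 'I_n -> X) (l : 'I_n -> R) (eps : R) :
    (forall i, D (y i)) -> (forall i, 0 <= l i) -> \sum_i l i = 1 -> 0 < eps ->
  exists l' : 'I_n -> R, [/\ forall i, 0 <= l' i, \sum_i l' i = 1,
    forall i, `|l' i - l i| < eps & D (\sum_i l' i *: y i)].
Proof.
elim: n => [|n IHn] in y l eps *.
  by move=> _ _ /eqP; rewrite big_ord0 eq_sym oner_eq0.
move=> Dy l0; rewrite big_ord_recl; set s := \sum_(i < n) _ => l1 eps0.
have s0 : 0 <= s by exact: sumr_ge0.
(* If [s = 0], renormalizing is impossible, but all the weight sits on [y ord0], already in [D]. *)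
have [sE|s_neq0] := eqVneq s 0.
  have lE i : l (lift ord0 i) = 0.
    by apply: (psumr_eq0P _ sE).
  exists l; split => //.
  - by rewrite big_ord_recl.
  - by move=> i; rewrite subrr normr0.
  - rewrite big_ord_recl big1 => [|i _]; last by rewrite lE scale0r.
    by move: l1; rewrite sE !addr0 => ->; rewrite scale1r.
have sp : 0 < s by rewrite lt_neqAle eq_sym s_neq0.
have e2 : 0 < eps / 2 by lra.
have [|i||m [m0 m1 ml Dm]] :=
  IHn (fun i => y (lift ord0 i)) (fun i => l (lift ord0 i) / s) _ _ _ _ e2 => //.
- by rewrite divr_ge0.
- by rewrite -mulr_suml divff.
set w := \sum_(i < n) _ in Dm.
have l01 : 0 <= l ord0 <= 1 by rewrite l0 /=; lra.
have [t [/andP[t0 t1] tl Dt]] :=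
  segment_dense_parameter hX (hD _ _ Dm (Dy ord0)) Dm l01 e2.
pose l' i := if unlift ord0 i is Some j then (1 - t) * m j else t.
have l'0 : l' ord0 = t by rewrite /l' unlift_none.
have l'S j : l' (lift ord0 j) = (1 - t) * m j by rewrite /l' liftK.
exists l'; split.
- move=> i; rewrite /l'; case: unlift => [j|//].
  by rewrite mulr_ge0// subr_ge0.
- rewrite big_ord_recl l'0; under eq_bigr do rewrite l'S.
  by rewrite -mulr_sumr m1 mulr1 addrC subrK.
- move=> i; case: (unliftP ord0 i) => [j|] ->; last by rewrite l'0; lra.
  rewrite l'S; set li := l _.
  (* The error splits into that of the parameter [t] and that of the weights [m], each worth
     [eps / 2] since [m j] and [s] are at most 1. *)
  have -> : (1 - t) * m j - li = (l ord0 - t) * m j + s * (m j - li / s).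
    have -> : s = 1 - l ord0 by lra.
    by field; lra.
  have mj1 : m j <= 1 by rewrite -m1 (bigD1 j)//= lerDl sumr_ge0.
  rewrite (le_lt_trans (ler_normD _ _))// !normrM.
  rewrite (ger0_norm s0) (ger0_norm (m0 j)) [eps]splitr ltr_leD//.
    by rewrite (le_lt_trans _ tl)// distrC ler_piMr.
  by rewrite (le_trans _ (ltW (ml j)))// ler_piMl//; lra.
- rewrite big_ord_recl l'0; under eq_bigr do rewrite l'S -scalerA.
  rewrite -scaler_sumr -/w; move: Dt; congr D.
  by rewrite scalerBr scalerBl scale1r addrCA.
Qed.

End SegmentDensity.

(** * Convex combinations and approximate solutions *)

Lemma convex_set_sum (R : realType) (X : lmodType R) (A : set X) (n : nat)
    (y : 'I_n -> X) (l : 'I_n -> R) :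
    convex_set A -> (forall i, A (y i)) -> (forall i, 0 <= l i) ->
    \sum_i l i = 1 ->
  A (\sum_i l i *: y i).
Proof.
move=> cA; elim: n => [|n IHn] in y l *.
  by move=> _ _ /eqP; rewrite big_ord0 eq_sym oner_eq0.
move=> Ay l0; rewrite !big_ord_recl; set s := \sum_(i < n) l _ => l1.
have s0 : 0 <= s by exact: sumr_ge0.
have [sE|s_neq0] := eqVneq s 0.
  rewrite big1 => [|i _].
    by move: l1; rewrite sE !addr0 => ->; rewrite scale1r.
  by rewrite (psumr_eq0P _ sE) ?scale0r.
have l01 : l ord0 <= 1 by lra.
pose w := \sum_(i < n) (l (lift ord0 i) / s) *: y (lift ord0 i).
have Aw : A w.
  apply: IHn => // [i|]; first by rewrite divr_ge0.
  by rewrite -mulr_suml divff.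
have : A (l ord0 *: y ord0 + (1 - l ord0) *: w).
  have := cA _ _ (Itv01 (l0 ord0) l01) (mem_set (Ay ord0)) (mem_set Aw).
  exact: set_mem.
congr A; congr (_ + _).
have -> : 1 - l ord0 = s by lra.
rewrite scaler_sumr; apply: eq_bigr => i _.
by rewrite scalerA mulrC divfK.
Qed.

(** The alternative is applied to [a i j + eps i]. Its second case gives weights [l] whose
    combination of the rows of [a] is at most [- d < 0] in every column; a small change of [l]
    brings the point into [D] and keeps the quadratic form negative, against the hypothesis. *)
Lemma approximate_solution (R : realType) (X : tvsType R)
    (hX : hausdorff_space X) (D : set X)
    (hD : forall x y, D x -> D y ->
       closed_segment x y `<=` closure (closed_segment x y `&` D))
    (n : nat) (y : 'I_n.+1 -> X) (a : 'I_n.+1 -> 'I_n.+1 -> R)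
    (eps : 'I_n.+1 -> R) :
    (forall i, D (y i)) -> (forall i, 0 < eps i) ->
    (forall l : 'I_n.+1 -> R, (forall i, 0 <= l i) -> \sum_i l i = 1 ->
       D (\sum_i l i *: y i) -> 0 <= \sum_i l i * \sum_j a i j * l j) ->
  exists mu : 'I_n.+1 -> R, [/\ forall j, 0 <= mu j, \sum_j mu j = 1 &
    forall i, - eps i <= \sum_j a i j * mu j].
Proof.
move=> Dy eps0 ha.
have [[mu [mu0 mu1 bmu]]|[l [l0 l1 lb]]] :=
    matrix_alternative (fun i j => a i j + eps i).
  exists mu; split => // i; rewrite -subr_ge0 opprK (le_trans (bmu i))//.
  under eq_bigr do rewrite mulrDl.
  by rewrite big_split -mulr_sumr mu1 mulr1.
pose d := \sum_i l i * eps i.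
have d0 : 0 < d.
  have d0 : 0 <= d by apply: sumr_ge0 => i _; rewrite mulr_ge0// ltW.
  rewrite lt_neqAle d0 andbT eq_sym; apply/eqP => dE.
  suff : \sum_i l i = 0 by rewrite l1 => /eqP; rewrite oner_eq0.
  apply: big1 => i _; apply: (mulIf (lt0r_neq0 (eps0 i))); rewrite mul0r.
  by apply: (psumr_eq0P _ dE) => // k _; rewrite mulr_ge0// ltW.
(* A perturbation below [d / (A + 1)] costs at most [d * A / (A + 1)], which is less than [d]. *)
pose A := \sum_j \sum_i `|a i j|.
have A0 : 0 <= A by do 2!apply: sumr_ge0 => ? _.
have eta0 : 0 < d / (A + 1) by rewrite divr_gt0// ltr_wpDl.
have [l' [l'0 l'1 ll' Dl']] := simplex_dense_weights hX hD Dy l0 l1 eta0.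
suff : \sum_i l' i * (\sum_j a i j * l' j) < 0 by rewrite ltNge ha.
under eq_bigr do rewrite mulr_sumr.
rewrite exchange_big/=.
have col j : \sum_i l' i * (a i j * l' j) <=
    l' j * - d + d / (A + 1) * \sum_i `|a i j|.
  have -> : \sum_i l' i * (a i j * l' j) =
      l' j * (\sum_i l i * a i j) + l' j * \sum_i (l' i - l i) * a i j.
    rewrite -mulrDr -big_split mulr_sumr; apply: eq_bigr => i _ /=.
    by ring.
  apply: lerD.
    rewrite ler_wpM2l// -subr_le0 opprK (le_trans _ (lb j))//.
    by rewrite -big_split ler_sum// => i _; rewrite mulrDr.
  have l'j1 : l' j <= 1 by rewrite -l'1 (bigD1 j)//= lerDl sumr_ge0.
  have le_abs : \sum_i (l' i - l i) * a i j <= d / (A + 1) * \sum_i `|a i j|.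
    rewrite mulr_sumr; apply: ler_sum => i _.
    rewrite (le_trans (ler_norm _))// normrM ler_wpM2r//.
    exact: ltW.
  rewrite (le_trans (ler_wpM2l (l'0 j) le_abs))// ler_piMl//.
  by rewrite mulr_ge0 ?(ltW eta0) ?sumr_ge0.
rewrite (le_lt_trans (ler_sum _ (fun j _ => col j)))//.
rewrite big_split /= -mulr_suml l'1 mul1r -mulr_sumr -/A addrC subr_lt0.
by rewrite mulrAC ltr_pdivrMr ?ltr_wpDl// mulrDr mulr1 ltrDl.
Qed.

(** * Compactness, and semicontinuity of positive functionals *)

(** A point of [A] turns [T] into a pointed space, on which [compact_In0] expresses compactness by
    finite intersections. *)
Lemma compact_finI_nonempty (T : topologicalType) (A : set T) (I : choiceType)
    (D : set I) (f : I -> set T) :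
    compact A -> A !=set0 -> closed_fam_of A D f -> finI D f ->
  \bigcap_(i in D) f i !=set0.
Proof.
move=> cA [t _].
pose pT : ptopologicalType :=
  HB.pack (T : Type) (isPointed.Build T t) (Topological.on T).
by have : @compact pT A := cA; rewrite compact_In0; exact.
Qed.

Lemma continuous_addrZ (R : realType) (X : tvsType R) (u : X) (a : R) :
  continuous (fun v : X => u + a *: v).
Proof.
move=> v; apply: (cvg_comp2 (cvg_cst u) _ (@add_continuous X (u, a *: v))).
exact: (cvg_comp2 (cvg_cst a) cvg_id (@scale_continuous R X (a, v))).
Qed.

(** The map [g] sends [u] to [e], so [g v] is in [C] for [v] near [u]; positivity of [p] then reads
    [p v <= p u + r], with [r] half the gap to [c]. *)
Lemma open_positive_functional_lt (R : realType) (Z : tvsType R) (C : set Z)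
    (p : {scalar Z}) (e : Z) (c : R) :
    interior C e -> (forall z, C z -> 0 <= p z) -> p e = 1 ->
  open [set u | p u < c].
Proof.
move=> Ce pC pe; rewrite openE => u /= puc.
pose r := (c - p u) / 2; have r0 : 0 < r by rewrite /r; lra.
pose g (v : Z) := e + r^-1 *: u + - r^-1 *: v.
have gcont : continuous g by exact: continuous_addrZ.
have gu : g u = e by rewrite /g scaleNr addrK.
have : nbhs u (g @^-1` C) by apply: gcont; rewrite gu.
apply: filterS => v /pC; rewrite !linearD !linearZ/= pe mulNr.
by rewrite -addrA -mulrBr -opprB mulrN subr_ge0 ler_pdivrMl// mulr1 /r; lra.
Qed.

(** Interior points leave room in every direction: this makes [e] an order unit and [p] strictly
    positive on the interior of [C]. *)
Lemma interior_line (R : realType) (Z : tvsType R) (C : set Z) (c z : Z) :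
  interior C c -> exists2 s : R, 0 < s & C (c + s *: z).
Proof.
move=> Cc.
have /nbhs_ballP[d /= d0 dC] : nbhs (0 : R) ((fun t : R => c + t *: z) @^-1` C).
  by apply: continuous_line; rewrite scale0r addr0.
exists (d / 2); first by rewrite divr_gt0.
by apply: dC; rewrite /ball/= sub0r normrN gtr0_norm ?divr_gt0//; lra.
Qed.

Theorem theorem5p3 (R : realType) (X Z : tvsType R)
    (hX : hausdorff_space X) (hZ : hausdorff_space Z)
    (* Z is not the zero space: otherwise 0 is in the interior of C = {0}
       and the conclusion cannot hold *)
    (hZ0 : exists z : Z, z != 0)
    (C : set Z) (hC : convex_cone C) (hCp : pointed_cone C)
    (hCi : interior C !=set0)
    (K : set X) (hK0 : K !=set0) (hKc : convex_set K) (hKk : compact K)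
    (D : set X) (hDK : D `<=` K) (hD : self_segment_dense D K)
    (F : X -> {linear X -> Z})
    (hF : forall y, K y -> linear_continuous_operators (F y))
    (hi : forall x, K x ->
       cone_usc_on C K (fun y => F y (y - x)) (K `\` D))
    (hii : forall x, D x ->
       cone_convex_on C D (fun y => F y (y - x))) :
  exists2 x0, K x0 &
    forall y, K y -> ~ [set - c | c in interior C] (F y (y - x0)).

Proof.
have [coneC CC] := hC.
have addC u v : C u -> C v -> C (u + v).
  by move=> Cu Cv; rewrite -CC; exists u => //; exists v.
have [e Ce] := hCi.
have Ce' := interior_subset Ce.
have unitC z : exists t, C (t *: e + z).
  have [s s0 Cs] := interior_line z Ce; exists s^-1.
  have -> : s^-1 *: e + z = s^-1 *: (e + s *: z).
    by rewrite scalerDr scalerA mulVf ?gt_eqF// scale1r.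
  by apply: coneC; rewrite // invr_ge0 ltW.
have pointedC z : C z -> C (- z) -> z = 0.
  move=> Cz CNz; have : (C `&` [set - c | c in C]) z.
    by split => //; exists (- z); rewrite ?opprK.
  by rewrite hCp.
(* Otherwise pointedness forces [e = 0]; the order unit property then puts every [z] and [- z] in
   [C], so [Z] would be zero. *)
have CNe : ~ C (- e).
  move=> /(pointedC _ Ce') e0; have [z /eqP] := hZ0; apply.
  have [t] := unitC z; have [t'] := unitC (- z).
  by rewrite e0 !scaler0 !add0r => CNz Cz; exact: pointedC.
have [p pe pC] := cone_positive_functional coneC addC unitC Ce' CNe.
have pint c : interior C c -> 0 < p c.
  move=> /(interior_line (- e))[s s0 /pC].
  by rewrite linearD linearZ linearN/= pe mulrN1 subr_ge0; exact: lt_le_trans.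
have openp a : open [set u | p u < a].
  exact: (@open_positive_functional_lt _ _ _ _ _ _ Ce pC pe).
have [_ _ Kcl Dseg] := hD.
have [y0 Dy0] : D !=set0.
  by have [k /Kcl/(_ _ filterT)[y [Dy _]]] := hK0; exists y.
(* An index pairs a point with a slack: finite subsystems are solved only approximately, and
   intersecting over all slacks recovers the exact inequality. *)
pose G (q : X * R) := [set x | - q.2 <= p (F q.1 (q.1 - x))].
pose I := [set q : X * R | D q.1 /\ 0 < q.2].
have [|D' D'I|x0 x0G] :=
    @compact_finI_nonempty X K _ I (fun q => K `&` G q) hKk hK0.
- exists G => // q [/hDK Kq _].
  have -> : G q = ~` ((fun x => F q.1 (q.1 - x)) @^-1` [set u | p u < - q.2]).
    by apply/seteqP; split => x; rewrite /G/= leNgt => /negP.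
  apply: open_closedC; apply: open_comp => // x _.
  have c1 : q.1 - x @[x --> x] --> q.1 - x.
    under eq_fun do rewrite -scaleN1r.
    by rewrite -scaleN1r; exact: continuous_addrZ.
  have cF : continuous (F q.1) := hF _ Kq.
  exact: (cvg_comp _ _ c1 (cF _)).
- case sE : (enum_fset D') => [|q0 s].
    have [k Kk] := hK0; exists k => q /=.
    by rewrite -[q \in D']/(q \in enum_fset D') sE.
  pose q (i : 'I_(size s).+1) := nth q0 (q0 :: s) i.
  have qI i : I (q i).
    by apply/set_mem/D'I; rewrite -[_ \in D']/(_ \in enum_fset D') sE mem_nth.
  pose y i := (q i).1.
  have Dy i : D (y i) := (qI i).1.
  pose a i j := p (F (y i) (y i - y j)).
  (* Since [mu] sums to 1 and [F (y i)] is linear, the constraint at a convex combination of the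
     [y j] is a row of the matrix applied to [mu]. *)
  have aE mu i : \sum_j mu j = 1 ->
      \sum_j a i j * mu j = p (F (y i) (y i - \sum_j mu j *: y j)).
    move=> mu1; rewrite -[X in X - _]scale1r -mu1.
    rewrite scaler_suml -sumrB !linear_sum.
    by apply: eq_bigr => j _; rewrite -scalerBr !linearZ/= mulrC.
  have [l l0 l1 Dl|mu [mu0 mu1 muG]] :=
      @approximate_solution _ _ hX _ Dseg _ y a (fun i => (q i).2) Dy
        (fun i => (qI i).2).
    (* Convexity is used with the combination itself as base point, so that its left side is the
       image of 0. *)
    have := pC _ (hii _ Dl _ _ _ Dy l0 l1 Dl).
    rewrite subrr linear0 subr0 linear_sum; congr (_ <= _).
    by apply: eq_bigr => i _; rewrite linearZ/= -aE.
  exists (\sum_j mu j *: y j) => r rD'; split.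
    by apply: convex_set_sum => // i; exact/hDK.
  have rs : r \in q0 :: s by rewrite -sE.
  have ri : (index r (q0 :: s) < (size s).+1)%N by rewrite index_mem.
  have := muG (Ordinal ri); rewrite aE// /y.
  by have -> : q (Ordinal ri) = r by rewrite /q nth_index.
have Kx0 : K x0 by have [] := x0G (y0, 1) (conj Dy0 ltr01).
have x0D y : D y -> 0 <= p (F y (y - x0)).
  move=> Dy; rewrite leNgt; apply/negP => py.
  (* Half of the supposed violation is a slack that [x0] would exceed. *)
  have py2 : 0 < - p (F y (y - x0)) / 2 by lra.
  by have [_] := x0G (y, _) (conj Dy py2); rewrite /G/=; lra.
exists x0 => // y Ky [c /pint pc cE].
have py : p (F y (y - x0)) < 0 by rewrite -cE linearN oppr_lt0.
have NDy : ~ D y by move=> /x0D; rewrite leNgt py.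
(* Semicontinuity at [y] carries the open condition [p < 0] to nearby points of [K], because
   subtracting elements of [C] only lowers [p]; density supplies such a point in [D], contradicting
   [x0D]. *)
have [U yU UK] := hi _ Kx0 _ (conj Ky NDy) _
  (open_nbhs_nbhs (conj (openp 0) py)).
have [u [Du Uu]] := Kcl _ Ky _ yU.
have [v /= pv [d Cd vd]] := UK _ (conj Uu (hDK _ Du)).
have := x0D _ Du; rewrite -vd linearB/= subr_ge0 leNgt.
by rewrite (lt_le_trans pv) ?pC.
Qed.
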